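(* Let $M$ be a multi-path matroid that is not a lattice path matroid. Then $M$ has a spanning circuit; moreover, every element of $M$ lies in some spanning circuit of $M$.
   Context: Transversal matroid $M[\mathcal{A}]$ of a multiset $\mathcal{A}=(A_j:j\in J)$ of subsets of a finite set $S$: independent sets are the sets $\{x_k:k\in K\}$ of $|K|$ distinct elements with $K\subseteq J$, $x_k\in A_k$. For a cyclic permutation $\sigma$ of $S$, a $\sigma$-interval is a nonempty set $\{f,\sigma(f),\ldots,l\}$. A multi-path matroid is a transversal matroid with a presentation by an antichain (no member containing another) of $\sigma$-intervals for some cyclic permutation $\sigma$ of the ground set. A lattice path matroid is a matroid isomorphic to $M[P,Q]$ for lattice paths $P,Q$ from $(0,0)$ to $(m,r)$ with $P$ never above $Q$, where $M[P,Q]$ is the transversal matroid on $[m+r]$ presented by $(N_1,\ldots,N_r)$, $N_i$ being the set of $j$ such that the $j$-th step of some lattice path from $(0,0)$ to $(m,r)$ staying weakly between $P$ and $Q$ is its $i$-th North step. A spanning circuit is a circuit whose closure is the whole ground set. *)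

(* Defs.v *)
From mathcomp Require Import all_boot all_fingroup.

Set Implicit Arguments.
Unset Strict Implicit.
Unset Printing Implicit Defensive.

Record matroid (S : finType) := Matroid {
  indep : {set {set S}};
  indep0 : set0 \in indep;
  indep_sub : forall I I' : {set S}, I' \in indep -> I \subset I' -> I \in indep;
  indep_aug : forall I I' : {set S}, I \in indep -> I' \in indep ->
    #|I| < #|I'| -> exists2 x, x \in I' :\: I & x |: I \in indep
}.

Section MatroidTheory.
Variable S : finType.
Implicit Types (M : matroid S) (X C : {set S}).

Definition mrank M X : nat := \max_(I in indep M | I \subset X) #|I|.

Definition mclosure M X : {set S} := [set x | mrank M (x |: X) == mrank M X].

Definition circuit M C : bool := minset [pred X | X \notin indep M] C.

Definition spanning_circuit M C : bool :=
  circuit M C && (mclosure M C == [set: S]).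

End MatroidTheory.

Definition matroid_iso (S T : finType) (M : matroid S) (N : matroid T) : Prop :=
  exists2 f : S -> T, bijective f &
    forall X : {set S}, (X \in indep M) = (f @: X \in indep N).

Section Transversal.
Variables (S J : finType) (A : J -> {set S}).
Implicit Types X Y : {set S}.

Definition partial_transversal X : bool :=
  [exists K : {set J}, exists x : {ffun {k : J | k \in K} -> S},
    [&& injectiveb x, [forall k, x k \in A (val k)] & X == [set x k | k in predT]]].

(* The same notion seen from the elements; values are in [option J] because J
   may be empty. *)
Definition matches X (g : S -> option J) : Prop :=
  {in X, forall s, exists2 k, g s = Some k & s \in A k} /\ {in X &, injective g}.

Lemma partial_transversalP X :
  reflect (exists g, matches X g) (partial_transversal X).
Proof.
apply: (iffP existsP) => [[K /existsP[x /and3P[/injectiveP xI /forallP xA /eqP->]]]|].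
  pose g s := omap val [pick k | x k == s].
  have gx k : g (x k) = Some (val k).
    rewrite /g; case: pickP => [k' /eqP/xI->//|/(_ k)]; by rewrite eqxx.
  exists g; split=> [s /imsetP[k _ ->]|s t /imsetP[k _ ->] /imsetP[k' _ ->]].
    by exists (val k).
  by rewrite !gx => -[/val_inj->].
case=> g [gA gI].
pose K := [set k | Some k \in g @: X].
have ex (k : {k : J | k \in K}) : exists s, (s \in X) && (g s == Some (val k)).
  case: k => k /= kK; move: kK; rewrite inE => /imsetP[s sX ->].
  by exists s; rewrite sX eqxx.
exists K; apply/existsP; exists [ffun k => xchoose (ex k)].
have P k : xchoose (ex k) \in X /\ g (xchoose (ex k)) = Some (val k).
  by have /andP[? /eqP] := xchooseP (ex k).
apply/and3P; split.
- apply/injectiveP => k k'; rewrite !ffunE => e; apply: val_inj.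
  by have [_ gk] := P k; have [_ gk'] := P k'; rewrite e gk' in gk; case: gk.
- apply/forallP=> k; rewrite ffunE; have [kX gk] := P k.
  by have [k' e sA] := gA _ kX; move: e sA; rewrite gk => -[<-].
apply/eqP/setP=> s; apply/idP/imsetP=> [sX|[k _ ->]]; last first.
  by rewrite ffunE; case: (P k).
have [k gs _] := gA _ sX.
have kK : k \in K by rewrite inE -gs imset_f.
exists (exist _ k kK) => //; rewrite ffunE.
have [cX gc] := P (exist _ k kK).
by apply: (gI _ _ sX cX); rewrite gc gs.
Qed.

Lemma partial_transversal0 : set0 \in [set X | partial_transversal X].
Proof.
rewrite inE; apply/partial_transversalP; exists (fun=> None).
by split=> ?; rewrite inE.
Qed.

Lemma partial_transversal_sub X Y :
  Y \in [set X | partial_transversal X] -> X \subset Y ->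
  X \in [set X | partial_transversal X].
Proof.
rewrite !inE => /partial_transversalP[g [gA gI]] /subsetP sXY.
apply/partial_transversalP; exists g; split=> [s /sXY/gA//|s t /sXY sY /sXY tY].
exact: gI.
Qed.

Lemma partial_transversal_aug X Y :
  X \in [set X | partial_transversal X] ->
  Y \in [set X | partial_transversal X] -> #|X| < #|Y| ->
  exists2 y, y \in Y :\: X & y |: X \in [set X | partial_transversal X].
Proof.
rewrite !inE => /partial_transversalP[g gM] /partial_transversalP[h [hA hI]] lXY.
have [n] := ubnP #|[set s in X :&: Y | g s != h s]|.
elim: n g gM => // n IHn g [gA gI]; rewrite ltnS => len.
have /subsetPn[_ /imsetP[y yY ->] hyN] : ~~ (h @: Y \subset g @: X).
  apply/negP => /subset_leq_card; rewrite !card_in_imset // leqNgt.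
  by rewrite lXY.
have [k hy yA] := hA _ yY.
pose g' s := if s == y then h y else g s.
have g'M : matches (y |: X) g'.
  split=> [s|s t]; rewrite /g' !inE.
    by case: eqP => [-> _|_ /= /gA//]; exists k.
  case: (eqVneq s y) => [-> _|_ /= sX]; case: (eqVneq t y) => [-> //|_ /=].
  - by move=> tX e; rewrite e imset_f in hyN.
  - by move=> _ e; rewrite -e imset_f in hyN.
  exact: gI.
have [yX|yX] := boolP (y \in X); last first.
  exists y; first by rewrite inE yX.
  by rewrite inE; apply/partial_transversalP; exists g'.
apply: (IHn g'); first by move: g'M; rewrite setUC (setUidPl _) ?sub1set.
apply: leq_trans len; apply: proper_card; apply/properP; split.
  apply/subsetP=> s; rewrite !inE /g'.
  by case: (eqVneq s y) => [->|//]; rewrite eqxx andbF.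
exists y; last by rewrite !inE /g' !eqxx andbF.
rewrite !inE yX yY; apply/eqP => e.
by rewrite -e imset_f in hyN.
Qed.

Definition transversal_matroid : matroid S :=
  Matroid partial_transversal0 partial_transversal_sub partial_transversal_aug.

End Transversal.

Definition cyclic_perm (S : finType) (sigma : {perm S}) : Prop :=
  forall x, porbit sigma x = [set: S].

(* For n at least #|S| - 1 the trajectory is all of S, which is itself the
   interval from f to sigma^-1 f. *)
Definition sigma_interval (S : finType) (sigma : {perm S}) (I : {set S}) : Prop :=
  exists f n, I = [set x in traject sigma f n.+1].

Definition antichain (S J : finType) (A : J -> {set S}) : Prop :=
  forall j k, j != k -> ~~ (A j \subset A k).

Definition multi_path_matroid (S : finType) (M : matroid S) : Prop :=
  exists (sigma : {perm S}) (J : finType) (A : J -> {set S}),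
    [/\ cyclic_perm sigma,
        forall j, sigma_interval sigma (A j),
        antichain A
      & indep M = indep (transversal_matroid A)].

(* A lattice path with m East and r North unit steps is the word of its steps,
   [true] standing for North. *)
Section LatticePaths.
Variables m r : nat.
Implicit Types P Q R : (m + r).-tuple bool.

Definition lattice_path R : bool := count_mem true R == r.

(* Ordinate of the point reached after k steps. *)
Definition height R (k : nat) : nat := count_mem true (take k R).

(* After k steps every path is on the line x + y = k, so P never goes above Q
   iff on each of these lines the point of P is no higher than that of Q. *)
Definition never_above P Q : bool :=
  [forall k : 'I_(m + r).+1, height P k <= height Q k].

(* Steps and North steps are both numbered from 0. *)
Definition north_steps P Q (i : 'I_r) : {set 'I_(m + r)} :=
  [set j | [exists R : (m + r).-tuple bool,
    [&& lattice_path R, never_above P R, never_above R Q,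
        tnth R j & height R j == i]]].

Definition path_matroid P Q : matroid 'I_(m + r) :=
  transversal_matroid (north_steps P Q).

End LatticePaths.

Definition lattice_path_matroid (S : finType) (M : matroid S) : Prop :=
  exists (m r : nat) (P Q : (m + r).-tuple bool),
    [/\ lattice_path P, lattice_path Q, never_above P Q
      & matroid_iso M (path_matroid P Q)].

(* Main.v *)
(** Let [F] be the set of first elements of the intervals of the presentation;
they are pairwise distinct because the intervals form an antichain, so [F] is a
basis.  If [F] is the whole ground set, the matroid is free; if some [x] is in
no interval other than one starting at [x], the cycle may be cut just before
[x] and the presentation becomes one by intervals of a linear order.  Both are
lattice path matroids.  Otherwise, for every [y] outside [F], the set [y |: F]
is a circuit: to match it without the first element [f], send each element on
the arc from [f] (excluded) to [y] (included) to the interval starting at the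
nearest first element strictly before it, and every other first element to its
own interval. *)

Require Import Defs.
From mathcomp Require Import all_boot all_fingroup.
From mathcomp Require Import zify.

Set Implicit Arguments.
Unset Strict Implicit.
Unset Printing Implicit Defensive.

(** * Presentations by intervals of a linear order *)

(** A matching is carried along the two bijections. This is how elements become step numbers and
    intervals become North-step indices. *)
Lemma partial_transversal_imset (S T J K : finType) (A : J -> {set S})
    (B : K -> {set T}) (phi : S -> T) (psi : J -> K) (X : {set S}) :
  bijective phi -> bijective psi ->
  (forall s j, (phi s \in B (psi j)) = (s \in A j)) ->
  partial_transversal A X = partial_transversal B (phi @: X).
Proof.
move=> [phi' phiK phiK'] [psi' psiK psiK'] AB.
apply/partial_transversalP/partial_transversalP => -[g [gA gI]].
  exists (fun t => omap psi (g (phi' t))); split=> [t|t u].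
    case/imsetP=> s sX ->; rewrite phiK; have [k -> sA] := gA _ sX.
    by exists (psi k); rewrite // AB.
  case/imsetP=> s sX ->; case/imsetP=> s' s'X ->; rewrite !phiK => e.
  congr phi; apply: gI => //; move: e.
  have [k -> _] := gA _ sX; have [k' -> _] := gA _ s'X.
  by case=> /(can_inj psiK) ->.
exists (fun s => omap psi' (g (phi s))); split=> [s sX|s s' sX s'X].
  have [k -> sB] := gA _ (imset_f phi sX).
  by exists (psi' k); rewrite // -AB psiK'.
have [k e _] := gA _ (imset_f phi sX); have [k' e' _] := gA _ (imset_f phi s'X).
rewrite e e' => -[/(can_inj psiK') kk'].
by apply: (can_inj phiK); apply: gI; rewrite ?imset_f // e e' kk'.
Qed.

Section WordOfPositions.
Variables (J : finType) (n : nat).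
Implicit Types g h : J -> nat.

Definition position_word g : n.-tuple bool :=
  [tuple [exists k, g k == i] | i < n].

Lemma tnth_position_word g (t : 'I_n) :
  tnth (position_word g) t = [exists k, g k == t].
Proof. by rewrite tnth_mktuple. Qed.

Lemma count_take_position_word g x : injective g -> x <= n ->
  count_mem true (take x (position_word g)) = #|[set k | g k < x]|.
Proof.
move=> gI; elim: x => [|x IHx] xn.
  by rewrite take0 /=; apply/esym/eqP; rewrite cards_eq0; apply/eqP/setP=> k; rewrite !inE.
rewrite (take_nth false) ?size_tuple // -cats1 count_cat IHx ?(ltnW xn) //= addn0.
have -> : nth false (position_word g) x = [exists k, g k == x].
  by rewrite -(tnth_nth false _ (Ordinal xn)) tnth_position_word.
have [/existsP[k /eqP gk]|/existsPn nx] := boolP [exists k, g k == x].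
  have -> : [set k | g k < x.+1] = k |: [set k | g k < x].
    apply/setP=> k'; rewrite !inE ltnS leq_eqVlt -gk; congr (_ || _).
    by apply/eqP/eqP => [/gI|->].
  by rewrite cardsU1 inE gk ltnn addnC.
rewrite addn0; apply: eq_card => k; rewrite !inE ltnS [in RHS]leq_eqVlt.
by rewrite (negPf (nx k)).
Qed.

End WordOfPositions.

(** The upper path takes its North steps at the left ends [f], the lower one at the right ends [l].
    Since the antichain condition sorts both kinds of ends alike, the possible places of the North
    step of index [i] form exactly the interval with [i] intervals starting before it. *)
Lemma linear_intervals_lattice_path (S J : finType) (A : J -> {set S})
    (M : matroid S) (pos : S -> nat) (f l : J -> nat) :
  injective pos -> (forall s, pos s < #|S|) ->
  (forall j, f j <= l j) -> (forall j, l j < #|S|) ->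
  (forall j s, (s \in A j) = (f j <= pos s <= l j)) ->
  antichain A -> indep M = indep (transversal_matroid A) ->
  lattice_path_matroid M.
Proof.
move=> posI posn fl ln AE anti ME.
(* If the two orders disagreed on a pair, one interval would contain the other. *)
have mono j k : (f j < f k) = (l j < l k).
  have H j1 k1 : f j1 <= f k1 -> l k1 <= l j1 -> j1 = k1.
    move=> h1 h2; apply/eqP; apply/negPn/negP => jk.
    have /negP[] := anti k1 j1 (contra_neq (@esym _ _ _) jk).
    by apply/subsetP => s; rewrite !AE; lia.
  apply/idP/idP => lt; rewrite ltnNge; apply/negP => le.
    by have e := H j k (ltnW lt) le; rewrite e ltnn in lt.
  by have e := H k j le (ltnW lt); rewrite e ltnn in lt.
have fI : injective f.
  move=> j k e; apply/eqP; apply/negPn/negP => jk.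
  have e' : l j = l k by have := mono j k; have := mono k j; lia.
  have /negP[] := anti j k jk.
  by apply/subsetP => s; rewrite !AE e e'.
have lI : injective l.
  by move=> j k e; apply: fI; have := mono j k; have := mono k j; lia.
have fn j : f j < #|S| by apply: leq_ltn_trans (ln j).
have rn : #|J| <= #|S|.
  have I : injective (fun j => Ordinal (fn j)) by move=> j k [] /fI.
  by rewrite -(card_ord #|S|); apply: leq_card I.
set r := #|J|; set m := #|S| - #|J|.
have nE : m + r = #|S| by rewrite subnK.
have ht (g : J -> nat) x : injective g -> x <= m + r ->
    height (position_word (m + r) g : (m + r).-tuple bool) x = #|[set k : J | g k < x]|.
  exact: count_take_position_word.
have lp (g : J -> nat) : injective g -> (forall k, g k < m + r) ->
    lattice_path (m := m) (r := r) (position_word (m + r) g).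
  move=> gI gn; rewrite /lattice_path.
  rewrite -(take_size (position_word _ g)) size_tuple.
  rewrite count_take_position_word //; apply/eqP.
  by apply: eq_card => k; rewrite !inE gn.
have na (g h : J -> nat) : injective g -> injective h -> (forall k, h k <= g k) ->
    never_above (m := m) (r := r) (position_word _ g) (position_word _ h).
  move=> gI hI hg; apply/forallP => -[x /= xn]; rewrite !ht //.
  by apply/subset_leq_card/subsetP => k; rewrite !inE; apply: leq_ltn_trans.
have rkP j : #|[set k | f k < f j]| < r.
  rewrite /r -cardsT; apply: proper_card; apply/properP; split=> //.
  by exists j; rewrite // inE ltnn.
(* The number of intervals starting before [A j] is the index, from 0, of its North step. *)
pose rk j : 'I_r := Ordinal (rkP j).
have rkI : injective rk.
  have H j k : f j < f k -> #|[set i | f i < f j]| < #|[set i | f i < f k]|.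
    move=> jk; apply: proper_card; apply/properP; split.
      by apply/subsetP => i; rewrite !inE => /ltn_trans; apply.
    by exists j; rewrite !inE ?ltnn.
  move=> j k [] e; apply: fI; have := H j k; have := H k j; rewrite e; lia.
pose phi s : 'I_(m + r) := cast_ord (esym nE) (Ordinal (posn s)).
have phiI : injective phi by move=> s t /cast_ord_inj[] /posI.
have lmr j : l j < m + r by rewrite nE.
have fmr j : f j < m + r by rewrite nE.
exists m, r, (position_word _ l), (position_word _ f).
split; [exact: lp | exact: lp | exact: na | ].
exists phi; first by apply: inj_card_bij => //; rewrite card_ord nE.
move=> X; rewrite ME /= !inE.
apply: (partial_transversal_imset (psi := rk)).
- by apply: inj_card_bij => //; rewrite card_ord nE.
- by apply: inj_card_bij => //; rewrite card_ord.
move=> s j; rewrite AE inE; set t := phi s.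
have tE : pos s = t by [].
rewrite tE; apply/existsP/idP.
  case=> R /and5P[_ /forallP PR /forallP RQ Rt /eqP hR].
  have tn : t < m + r by [].
  have hR1 : height R t.+1 = (rk j).+1.
    rewrite -hR /height (take_nth false) ?size_tuple // -cats1 count_cat.
    by rewrite -tnth_nth Rt /= addn0 addn1.
  have := PR (widen_ord (leqnSn _) t); have := RQ (Ordinal (tn : t.+1 < (m + r).+1)).
  rewrite /= hR1 hR !ht //; last exact: ltnW.
  (* Step [t] lifts [R] from height [rk j] to [rk j + 1]. If [t < f j], the upper path is still at
     most [rk j] high after that step; if [l j < t], the lower path is already at least [rk j + 1]
     high before it. *)
  move=> h1 h2; apply/andP; split; rewrite leqNgt; apply/negP => h.
    have : #|[set k | f k < t.+1]| <= #|[set k | f k < f j]|.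
      by apply/subset_leq_card/subsetP => k; rewrite !inE; lia.
    by move: h1; rewrite /=; lia.
  have : #|j |: [set k | f k < f j]| <= #|[set k | l k < t]|.
    apply/subset_leq_card/subsetP => k; rewrite !inE => /orP[/eqP->//|].
    by rewrite mono => /ltn_trans; apply.
  by rewrite cardsU1 inE ltnn /=; move: h2 => /=; lia.
case/andP=> ft tl.
(* A path through the required step: earlier intervals use their left ends, later ones their right
   ends, so exactly [rk j] North steps precede [t]. *)
pose g k := if k == j then t : nat else if f k < f j then f k else l k.
have gI : injective g.
  move=> k k'; rewrite /g.
  case: (eqVneq k j) => [->|kj]; case: (eqVneq k' j) => [->|k'j] //.
  - case: ifP => h e; first lia.
    by move: h; rewrite mono => h; apply: lI; lia.
  - case: ifP => h e; first lia.
    by move: h; rewrite mono => h; apply: lI; lia.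
  case: ifP => h; case: ifP => h'; first by move/fI.
  - by move: (h) (h') (fl k); rewrite !mono; have := fl j; lia.
  - by move: (h) (h') (fl k'); rewrite !mono; have := fl j; lia.
  - by move/lI.
have gl k : g k <= l k.
  by rewrite /g; case: eqP => [->//|_]; case: ifP.
have fg k : f k <= g k.
  by rewrite /g; case: eqP => [->//|_]; case: ifP.
exists (position_word _ g); apply/and5P; split.
- by apply: lp => // k; apply: leq_ltn_trans (gl k) _.
- exact: na.
- exact: na.
- by rewrite tnth_position_word; apply/existsP; exists j; rewrite /g eqxx.
rewrite ht //; last exact: ltnW.
apply/eqP; apply: eq_card => k; rewrite !inE /g.
case: (eqVneq k j) => [->|kj]; first by rewrite !ltnn.
case: ifP => h; first by lia.
by move: h; rewrite mono; lia.
Qed.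

Lemma free_lattice_path (S : finType) (M : matroid S) :
  [set: S] \in indep M -> lattice_path_matroid M.
Proof.
move=> MT.
apply: (@linear_intervals_lattice_path _ S (fun s => [set s]) M enum_rank
  enum_rank enum_rank).
- by move=> s t /val_inj/enum_rank_inj.
- by move=> s; apply: ltn_ord.
- by [].
- by move=> s; apply: ltn_ord.
- move=> j s; rewrite in_set1 -eqn_leq eq_sym.
  by apply/eqP/eqP => [->//|/val_inj/enum_rank_inj].
- by move=> j k jk; rewrite sub1set inE.
apply/setP=> X; rewrite (indep_sub MT) ?subsetT //= inE; apply/esym.
by apply/partial_transversalP; exists Some; split=> [s _|s t _ _ []//]; exists s; rewrite ?set11.
Qed.

(** * Presentations by intervals of a cyclic order *)

Section CyclicIntervals.
Variables (S : finType) (sigma : {perm S}).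
Hypothesis cyc : cyclic_perm sigma.

Lemma cyclic_iterP x y : exists2 i, i < #|S| & y = iter i sigma x.
Proof.
have : y \in porbit sigma x by rewrite cyc inE.
by rewrite porbit_traject cyc cardsT => /trajectP.
Qed.

Lemma cyclic_iter_card x : iter #|S| sigma x = x.
Proof. by have := iter_porbit sigma x; rewrite cyc cardsT. Qed.

Lemma cyclic_iter_inj x i j : i < #|S| -> j < #|S| ->
  iter i sigma x = iter j sigma x -> i = j.
Proof.
have := uniq_traject_porbit sigma x; rewrite cyc cardsT => u iS jS e.
by apply/eqP; rewrite -(nth_uniq x _ _ u) ?size_traject // !nth_traject ?e.
Qed.

Lemma iter_perm_inj i : injective (iter i sigma).
Proof. by elim: i => [//|i IHi] x y /= /perm_inj/IHi. Qed.

(** A longer trajectory already covers the whole cycle, so it can be cut to [#|S|] terms. The pair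
    lets start and length be chosen together for all intervals. *)
Lemma sigma_interval_short I : sigma_interval sigma I ->
  exists p : S * nat, p.2 < #|S| /\ I = [set x in traject sigma p.1 p.2.+1].
Proof.
case=> f [n ->].
have S_gt0 : 0 < #|S| by apply/card_gt0P; exists f.
have [nS|Sn] := ltnP n #|S|; first by exists (f, n).
exists (f, #|S|.-1); split; first by rewrite /= prednK.
rewrite [(_, _).1]/= [(_, _).2]/= (prednK S_gt0).
apply/setP=> x; rewrite !in_set.
have [i iS ->] := cyclic_iterP f x.
by apply/trajectP/trajectP => _; exists i => //; lia.
Qed.

Variables (J : finType) (A : J -> {set S}) (first : J -> S) (len : J -> nat).
Hypothesis lenS : forall j, len j < #|S|.
Hypothesis AE : forall j, A j = [set x in traject sigma (first j) (len j).+1].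
Hypothesis anti : antichain A.

Lemma mem_intervalP j x :
  reflect (exists2 i, i <= len j & x = iter i sigma (first j)) (x \in A j).
Proof.
by rewrite AE in_set; apply: (iffP trajectP) => -[i ij ->]; exists i.
Qed.

Lemma first_mem j : first j \in A j.
Proof. by apply/mem_intervalP; exists 0. Qed.

Lemma antichain_eq j k : A j \subset A k -> j = k.
Proof. by move=> jk; apply/eqP; apply: contraTT jk => /anti. Qed.

Lemma first_inj : injective first.
Proof.
have H j k : first j = first k -> len j <= len k -> j = k.
  move=> e le; apply: antichain_eq; apply/subsetP=> x /mem_intervalP[i ij ->].
  by apply/mem_intervalP; exists i; rewrite ?e //; apply: leq_trans le.
by move=> j k e; have [le|/ltnW le] := leqP (len j) (len k); [|apply/esym]; apply: H.
Qed.

Lemma first_indep : first @: J \in indep (transversal_matroid A).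
Proof.
rewrite inE; apply/partial_transversalP.
exists (fun s => [pick j | first j == s]).
have H j : [pick k | first k == first j] = Some j.
  by case: pickP => [k /eqP/first_inj->//|/(_ j)]; rewrite eqxx.
split=> [s /imsetP[j _ ->]|s t /imsetP[j _ ->] /imsetP[k _ ->]].
  by exists j; rewrite ?H ?first_mem.
by rewrite !H => -[->].
Qed.

(** Number the elements along the cycle from [x0]: an interval running past the last number would
    contain [x0], hence start there, and would then be too long. *)
Lemma cut_lattice_path (M : matroid S) x0 :
  indep M = indep (transversal_matroid A) ->
  (forall k, x0 \in A k -> first k = x0) -> lattice_path_matroid M.
Proof.
move=> ME cut.
have /fin_all_exists2[pos posS posE] := cyclic_iterP x0.
have short k : pos (first k) + len k < #|S|.
  rewrite ltnNge; apply/negP => wrap; have pS := posS (first k).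
  have x0k : x0 = iter (#|S| - pos (first k)) sigma (first k).
    by rewrite {2}(posE (first k)) -iterD subnK ?cyclic_iter_card // ltnW.
  have e : first k = x0.
    by apply: cut; apply/mem_intervalP; exists (#|S| - pos (first k)); rewrite ?leq_subLR.
  have p0 : pos (first k) = 0.
    by apply: (@cyclic_iter_inj x0) => //; [lia | rewrite -posE].
  by have := lenS k; lia.
apply: (@linear_intervals_lattice_path _ _ A M pos (fun k => pos (first k))
  (fun k => pos (first k) + len k)) => //.
- by move=> s t e; rewrite (posE s) e -posE.
- by move=> k; apply: leq_addr.
move=> k s; apply/mem_intervalP/andP => [[i ik sE]|[h1 h2]].
  suff -> : pos s = i + pos (first k) by lia.
  apply: (@cyclic_iter_inj x0); [exact: posS | by have := short k; lia |].
  by rewrite -posE iterD -posE.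
exists (pos s - pos (first k)); first lia.
by rewrite {2}(posE (first k)) -iterD subnK // -posE.
Qed.

(** * Spanning circuits when the cycle cannot be cut *)

Hypothesis uncut : forall x, exists2 k, x \in A k & first k != x.

(** Some [A k] contains [x] without starting there, and by nearness it starts no later than
    [first i]. If [A i] stopped before [x], it would lie inside [A k]. *)
Lemma preceding_interval_mem i b x :
  0 < b -> x = iter b sigma (first i) ->
  (forall c k, 0 < c < b -> x != iter c sigma (first k)) -> x \in A i.
Proof.
move=> b0 xE nearest; have [k /mem_intervalP[a ak xa] kx] := uncut x.
have ba : b <= a.
  rewrite leqNgt; apply/negP => ab.
  have a0 : 0 < a by case: a xa {ak ab} => // xa; rewrite xa eqxx in kx.
  by have := nearest a k; rewrite a0 ab xa eqxx => /(_ isT).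
have iE : first i = iter (a - b) sigma (first k).
  by apply: (@iter_perm_inj b); rewrite -xE -iterD subnKC.
apply/negPn/negP => xi.
have ib : len i < b.
  by rewrite ltnNge; apply: contra xi => le; apply/mem_intervalP; exists b.
suff e : i = k by move: xi; rewrite e => /negP[]; apply/mem_intervalP; exists a.
apply: antichain_eq; apply/subsetP=> s /mem_intervalP[c ci ->].
by apply/mem_intervalP; exists (c + (a - b)); [lia | rewrite iterD -iE].
Qed.

Lemma exchange_first_indep y j : y \notin first @: J ->
  (y |: first @: J) :\ first j \in indep (transversal_matroid A).
Proof.
move=> yF.
(* Positions are counted from the removed element, so the arc to be shifted consists of the
   positions from 1 to [pos y]. *)
have /fin_all_exists2[pos posS posE] := cyclic_iterP (first j).
have posK c : c < #|S| -> pos (iter c sigma (first j)) = c.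
  by move=> cS; apply/esym; apply: (@cyclic_iter_inj (first j)); rewrite -?posE.
have posI s t : pos s = pos t -> s = t by move=> e; rewrite (posE s) e -posE.
have pos0 : pos (first j) = 0 by apply: (posK 0); apply: leq_ltn_trans (posS y).
have prev x : 0 < pos x -> exists i,
    pos (first i) < pos x /\ (forall k, pos (first k) < pos x -> pos (first k) <= pos (first i)).
  move=> x0; have Pj : pos (first j) < pos x by rewrite pos0.
  exists [arg max_(i > j | pos (first i) < pos x) pos (first i)].
  by case: arg_maxnP => // i ix max; split.
have prevA x i : pos (first i) < pos x ->
    (forall k, pos (first k) < pos x -> pos (first k) <= pos (first i)) -> x \in A i.
  move=> ix max; apply: (@preceding_interval_mem _ (pos x - pos (first i))).
  - lia.
  - by rewrite {2}(posE (first i)) -iterD subnK 1?ltnW // -posE.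
  move=> c k /andP[c0 cb]; apply/eqP => xE.
  have kE : first k = iter (pos x - c) sigma (first j).
    apply: (@iter_perm_inj c); rewrite -xE -iterD subnKC //; lia.
  have := max k; rewrite kE posK; first lia.
  by have := posS x; lia.
(* The rule that picks the interval is recorded with the choice, because injectivity is read off
   from it. *)
have ex (s : S) : exists o : option J, s \in (y |: first @: J) :\ first j ->
  exists2 i, o = Some i & s \in A i /\
   (if pos s <= pos y then pos (first i) < pos s /\
      (forall k, pos (first k) < pos s -> pos (first k) <= pos (first i))
    else s = first i).
  have [|] := boolP (s \in (y |: first @: J) :\ first j); last by exists None.
  rewrite !inE => /andP[sj sF].
  have [le|lt] := leqP (pos s) (pos y).
    have s0 : 0 < pos s.
      rewrite lt0n; apply: contra sj => /eqP s0; apply/eqP; apply: posI.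
      by rewrite s0 pos0.
    have [i [ix max]] := prev _ s0.
    by exists (Some i) => _; exists i => //; split=> //; apply: prevA.
  case/orP: sF => [/eqP e|/imsetP[i _ ->]]; first by rewrite e ltnn in lt.
  by exists (Some i) => _; exists i => //; split; rewrite ?first_mem.
have [g gP] := fin_all_exists ex.
rewrite inE; apply/partial_transversalP; exists g; split=> [s /gP[i -> []]|s t sC tC].
  by exists i.
have [i -> [_ si]] := gP _ sC; have [k -> [_ tk]] := gP _ tC => -[ik].
have low u v : u \in (y |: first @: J) :\ first j -> pos u < pos v ->
    pos v <= pos y -> exists k, u = first k.
  rewrite !inE => /andP[_ /orP[/eqP->|/imsetP[k' _ ->]]] uv vy; first lia.
  by exists k'.
rewrite -{k}ik in tk; apply: posI; move: si tk.
(* On the arc, the earlier of two elements is itself a first element by [low], so the later one is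
   sent to an interval starting there or beyond. In the mixed cases one interval would start both
   before and after [y]. *)
case: (leqP (pos s) (pos y)) => sy; case: (leqP (pos t) (pos y)) => ty.
- move=> [h1 m1] [h2 m2].
  case: (ltngtP (pos s) (pos t)) => // st.
    by have [k e] := low _ _ sC st ty; have := m2 k; rewrite -e; lia.
  by have [k e] := low _ _ tC st sy; have := m1 k; rewrite -e; lia.
- by move=> [h1 m1] e; move: h1; rewrite -e; lia.
- by move=> e [h1 m1]; move: h1; rewrite -e; lia.
by move=> -> ->.
Qed.

(** No independent set has more than [#|J|] elements, so [y |: first @: J] is dependent and every
    set containing [first @: J] has full rank. Deleting [y] leaves the basis; deleting a first
    element is the exchange above. *)
Lemma first_spanning_circuit (M : matroid S) y :
  indep M = indep (transversal_matroid A) -> y \notin first @: J ->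
  spanning_circuit M (y |: first @: J).
Proof.
move=> ME yF.
have cardF : #|first @: J| = #|J| by rewrite card_imset //; apply: first_inj.
have bound I : I \in indep M -> #|I| <= #|J|.
  rewrite ME inE => /partial_transversalP[g [gA gI]].
  rewrite -(card_in_imset gI).
  apply: leq_trans (_ : #|Some @: J| <= _); last exact: leq_imset_card.
  apply/subset_leq_card/subsetP => _ /imsetP[s sI ->].
  by have [k -> _] := gA _ sI; apply: imset_f.
have rankE (X : {set S}) : first @: J \subset X -> mrank M X = #|J|.
  move=> FX; apply/eqP; rewrite eqn_leq; apply/andP; split.
    by apply/bigmax_leqP => I /andP[/bound].
  rewrite -cardF; apply: (leq_bigmax_cond (F := fun I : {set S} => #|I|)).
  by rewrite ME first_indep FX.
apply/andP; split; last first.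
  apply/eqP/setP => x; rewrite !inE !rankE ?eqxx ?subsetUr //.
  by rewrite setUA subsetUr.
have sub c : c \in y |: first @: J -> (y |: first @: J) :\ c \in indep M.
  rewrite ME in_setU1 => /orP[/eqP->|/imsetP[j _ ->]].
    by rewrite setU1K // first_indep.
  exact: exchange_first_indep.
apply/minsetP; split=> [|B /= BM BC].
  by apply/negP => /bound; rewrite cardsU1 yF cardF add1n ltnn.
apply/eqP; rewrite eqEsubset BC; apply/subsetP=> c cC.
apply: contraNT BM => cB; apply: (indep_sub (sub c cC)).
by rewrite subsetD1 BC.
Qed.

End CyclicIntervals.

Theorem theorem6p1 (S : finType) (M : matroid S)
    (hM : multi_path_matroid M) (hL : ~ lattice_path_matroid M) :
  (exists C : {set S}, spanning_circuit M C) /\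
  (forall x : S, exists C : {set S}, spanning_circuit M C /\ x \in C).
Proof.
case: hM => sigma [J [A [cyc intA anti ME]]].
have /fin_all_exists[p pP] j := sigma_interval_short cyc (intA j).
pose first j := (p j).1; pose len j := (p j).2.
have lenS j : len j < #|S| by case: (pP j).
have AE j : A j = [set x in traject sigma (first j) (len j).+1] by case: (pP j).
have uncut x : exists2 k, x \in A k & first k != x.
  have [/existsP[k /andP[xk kx]]|/existsPn none] :=
    boolP [exists k, (x \in A k) && (first k != x)]; first by exists k.
  case: hL; apply: (cut_lattice_path cyc lenS AE anti (x0 := x) ME) => k xk.
  by have := none k; rewrite xk /= negbK => /eqP.
have circ := first_spanning_circuit cyc AE anti uncut ME.
have [y yF] : exists y, y \notin first @: J.
  have [/forallP all_first|/forallPn//] := boolP [forall y, y \in first @: J].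
  case: hL; apply: free_lattice_path; rewrite ME.
  have <- : first @: J = [set: S] by apply/setP => y; rewrite inE all_first.
  exact: (first_indep AE anti).
split=> [|x]; first by exists (y |: first @: J); apply: circ.
(* A first element lies in the circuit of any [y] outside the basis; any other [x] gives its own
   circuit. *)
have [xF|xF] := boolP (x \in first @: J).
  by exists (y |: first @: J); rewrite circ // setU1r.
by exists (x |: first @: J); rewrite circ // setU11.
Qed.
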